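(* Let $n\ge 1$ and let $\mathbf{c}=(c_1,\dots,c_n)$ be a tuple of positive integers. There is a bijection between the set $\mathcal{R}_S(\mathbf{c})$ of regions of the asymmetric $\mathbf{c}$-Shi arrangement $\mathcal{A}_{\mathrm{Shi}}^{\mathbf{c}}$ and the set $\mathcal{B}(\mathbf{c})$ of $\mathbf{c}$-building functions.
   Context: Notation: $[n]=\{1,\dots,n\}$; for integers $a\le b$, $[a,b]=\{a,a+1,\dots,b\}$. For each $i\in[n]$ put $m_i=(c_i+1)/2$ if $c_i$ is odd and $m_i=c_i/2$ if $c_i$ is even. Let $I=\{i\in[n] : c_i \text{ is odd}\}$ and let $\mathbf{1}_I$ be its indicator function ($\mathbf{1}_I(i)=1$ if $i\in I$ and $0$ otherwise). Asymmetric $\mathbf{c}$-Shi arrangement: the finite collection $\mathcal{A}_{\mathrm{Shi}}^{\mathbf{c}}$ of all affine hyperplanes $\{x\in\mathbb{R}^n : x_i-x_j=k\}$ with $1\le i<j\le n$ and $k\in[-m_i-m_j+1+\mathbf{1}_I(i),\; m_i+m_j-\mathbf{1}_I(j)]$. A region of a hyperplane arrangement $\mathcal{A}$ in $\mathbb{R}^n$ is a connected component of $\mathbb{R}^n\setminus\bigcup_{H\in\mathcal{A}}H$. $\mathbf{c}$-building functions: given $a=(a_1,\dots,a_n)\in\mathbb{Z}_{\ge0}^n$, run the following process. Start with $M_0=\emptyset$ and $W_0=[n]$. At step $t=1,\dots,n$, let $H_{t-1}=\sum_{j\in M_{t-1}}c_j$ and $E_t=\{i\in W_{t-1} : a_i\le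 H_{t-1}\}$. If $E_t=\emptyset$ (while $W_{t-1}\neq\emptyset$) the process stops in a deadlock; otherwise choose any $v\in E_t$ and set $M_t=M_{t-1}\cup\{v\}$, $W_t=W_{t-1}\setminus\{v\}$. (Whether the process deadlocks does not depend on the choices made.) The sequence $a$ is a $\mathbf{c}$-building function if the process terminates with $M_n=[n]$ and $W_n=\emptyset$. $\mathcal{B}(\mathbf{c})$ is the set of all $\mathbf{c}$-building functions. *)

(* Defs.v *)
From HB Require Import structures.
From mathcomp Require Import all_boot all_order all_algebra.
From mathcomp Require Import all_classical all_reals topology normedtype.
Import Order.TTheory GRing.Theory Num.Theory.
Import numFieldNormedType.Exports.

Set Implicit Arguments.
Unset Strict Implicit.
Unset Printing Implicit Defensive.

Local Open Scope classical_set_scope.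
Local Open Scope ring_scope.

(* The index set [n] = {1, ..., n} is rendered as 'I_n = {0, ..., n-1}; the
   arrangement depends only on the order of the indices. *)

Definition half_weight n (c : 'I_n -> nat) (i : 'I_n) : nat :=
  if odd (c i) then ((c i).+1 %/ 2)%N else (c i %/ 2)%N.

Definition odd_ind n (c : 'I_n -> nat) (i : 'I_n) : nat := odd (c i).

Definition diff_hyperplane (R : realType) n (i j : 'I_n) (k : int) :
    set 'rV[R]_n :=
  [set x | x ord0 i - x ord0 j = k%:~R].

Definition shi_arrangement (R : realType) n (c : 'I_n -> nat) :
    set (set 'rV[R]_n) :=
  [set H | exists (i j : 'I_n) (k : int),
    [/\ (i < j)%N,
        - (half_weight c i)%:Z - (half_weight c j)%:Z + 1
          + (odd_ind c i)%:Z <= k,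
        k <= (half_weight c i)%:Z + (half_weight c j)%:Z - (odd_ind c j)%:Z
      & H = diff_hyperplane i j k]].

Arguments shi_arrangement R {n} c.

Definition arr_complement (R : realType) n (A : set (set 'rV[R]_n)) :
    set 'rV[R]_n :=
  ~` \bigcup_(H in A) H.

Definition regions (R : realType) n (A : set (set 'rV[R]_n)) :
    set (set 'rV[R]_n) :=
  [set C | exists2 x, arr_complement A x &
     C = connected_component (arr_complement A) x].

(* E_t as a function of M_{t-1}; the waiting set W_{t-1} is the complement of
   M_{t-1}. *)
Definition eligible n (c : 'I_n -> nat) (a : {ffun 'I_n -> nat})
    (M : {set 'I_n}) : {set 'I_n} :=
  [set i in ~: M | (a i <= \sum_(j in M) c j)%N]%SET.

(* build_run c a t M: some choice of v's leads, without deadlock, to M_t = M. *)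
Inductive build_run n (c : 'I_n -> nat) (a : {ffun 'I_n -> nat}) :
    nat -> {set 'I_n} -> Prop :=
| build_start : build_run c a 0 finset.set0
| build_step t M v : build_run c a t M -> v \in eligible c a M ->
    build_run c a t.+1 (v |: M)%SET.

Definition building n (c : 'I_n -> nat) : set {ffun 'I_n -> nat} :=
  [set a | build_run c a n [set: 'I_n]%SET].

Lemma build_run_card n (c : 'I_n -> nat) a t M :
  build_run c a t M -> #|M| = t.
Proof.
elim=> [|{}t {}M v _ IH]; first by rewrite cards0.
by rewrite inE finset.in_setC => /andP[vM _]; rewrite cardsU1 vM IH.
Qed.

(* The outcome does not depend on the choices: a completed run exists iff no
   run ever deadlocks. *)
Lemma building_no_deadlock n (c : 'I_n -> nat) (a : {ffun 'I_n -> nat}) :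
  building c a <->
  (forall t M, build_run c a t M -> M != [set: 'I_n]%SET ->
     eligible c a M != finset.set0).
Proof.
split.
  move=> ba t M _ MT; apply/eqP => E0.
  suff sub s N : build_run c a s N -> N \subset M.
    by case/negP: MT; rewrite -finset.subTset (sub _ _ ba).
  elim=> [|{}s {}N v _ NM]; first exact: finset.sub0set.
  rewrite inE finset.in_setC => /andP[_ le_a].
  rewrite finset.subUset finset.sub1set NM andbT; apply/negPn/negP => vM.
  suff : v \in eligible c a M by rewrite E0 inE.
  rewrite inE finset.in_setC vM (leq_trans le_a) //.
  rewrite [leqRHS](big_setID N) /= (finset.setIidPr NM); exact: leq_addr.
move=> nd.
have run t : (t <= n)%N -> exists M, build_run c a t M.
  elim: t => [|t IH] tn; first by exists finset.set0; constructor.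
  have [M rM] := IH (ltnW tn).
  have MT : M != [set: 'I_n]%SET.
    apply/eqP => MT; move: (build_run_card rM) tn.
    by rewrite MT cardsT card_ord => ->; rewrite ltnn.
  have /set0Pn[v vE] := nd t M rM MT.
  by exists (v |: M)%SET; constructor.
have [M rM] := run n (leqnn n).
rewrite /building /=.
suff <- : M = [set: 'I_n]%SET by [].
apply/eqP; rewrite eqEcard finset.subsetT cardsT card_ord.
by rewrite (build_run_card rM) leqnn.
Qed.

(* Main.v *)
(* After translating x_i by an integer, the hyperplanes become y_i - y_j = k,
   1 - c_j <= k <= c_i for i < j: each ordered pair (i, j), i <> j, contributes
   c_i levels, namely y_i - y_j = 1, ..., c_i if i < j and 0, ..., c_i - 1 if
   j < i.  As in the Pak-Stanley labelling, a region is sent to the function a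
   with a_j the number of pairs (i, level of (i, j)) such that y_i - y_j exceeds
   the level.  If some level of (i, j) is exceeded then a_i < a_j; since a is
   building iff a_v <= sum of the c_i with a_i < a_v, the labels are building
   functions.

   Injectivity: if y and z have the same label and disagree on a level of
   (i, j), they disagree in the opposite direction on a level of some (i', j);
   the difference of these two levels yields a disagreement between i and i', at
   a vertex of smaller label, and strong induction on the label concludes.

   Surjectivity: insert the coordinates by increasing a_j.  Lowering the new
   coordinate raises its label by at most one at a time, and below every old
   coordinate it does not affect the old labels.  The coordinates are kept
   integral, with the unit N doubled at each insertion, so that the new
   coordinate sits at a half-integer of the previous scale. *)
Require Import Defs.
From mathcomp Require Import all_boot all_order all_algebra.
From mathcomp Require Import all_classical all_reals topology normedtype.
From mathcomp Require Import zify ring lra.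
Import Order.TTheory GRing.Theory Num.Theory.
Import numFieldNormedType.Exports.

Set Implicit Arguments.
Unset Strict Implicit.
Unset Printing Implicit Defensive.

Local Open Scope ring_scope.

(** * Levels crossed by one ordered pair *)

Section Counting.
Variable R : realDomainType.
Implicit Types (N h t : R) (e : bool) (m k : nat).

(* [e = true] shifts the counted levels from 0, ..., m-1 to 1, ..., m. *)
Definition count_below N e m h t : nat :=
  (\sum_(k < m) (t + N *+ (k + e) < h)%R)%N.

Lemma count_below_le N e e' m h t t' : t + N *+ e <= t' + N *+ e' ->
  (count_below N e' m h t' <= count_below N e m h t)%N.
Proof.
move=> le_t; apply: leq_sum => k _.
case: ltP => // lt_h; rewrite (le_lt_trans _ lt_h) //.
by rewrite !mulrnDr !(addrC (N *+ k)) !addrA lerD2r.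
Qed.

Lemma count_below_max N e m h t : (count_below N e m h t <= m)%N.
Proof.
rewrite -[leqRHS]muln1 -[X in (_ <= X * _)%N]card_ord -sum_nat_const.
by apply: leq_sum => k _; case: (_ < _).
Qed.

Lemma count_below0 N e m h t : 0 <= N -> h <= t + N *+ e ->
  count_below N e m h t = 0%N.
Proof.
move=> N0 le_h; apply: big1 => k _; apply/eqP; rewrite eqb0 -leNgt.
by rewrite (le_trans le_h) // lerD2l mulrnDr lerDr mulrn_wge0.
Qed.

Lemma count_below_gt0 N e m h t : 0 <= N ->
  (0 < count_below N e m h t)%N -> t + N *+ e < h.
Proof.
by move=> N0; case: ltP => // le_h; rewrite count_below0.
Qed.

Lemma count_below_lt N e m h t h' t' :
  (count_below N e m h' t' < count_below N e m h t)%N ->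
  exists2 k, (k < m)%N & (t + N *+ (k + e) < h) && (h' <= t' + N *+ (k + e)).
Proof.
move=> lt_c.
suff /existsP[k /andP[hk hk']] : [exists k : 'I_m,
    (t + N *+ (k + e) < h) && (h' <= t' + N *+ (k + e))].
  by exists k => //; rewrite hk.
apply: contraLR lt_c; rewrite negb_exists -leqNgt => /forallP nex.
by apply: leq_sum => k _; move: (nex k); rewrite leNgt; do 2 case: (_ < _).
Qed.

(** The levels do not decrease with [k], so the crossed ones form an initial segment, which its
    cardinality determines. *)
Lemma count_below_inj N e m h t h' t' k : 0 <= N -> (k < m)%N ->
  count_below N e m h t = count_below N e m h' t' ->
  (t + N *+ (k + e) < h) = (t' + N *+ (k + e) < h').
Proof.
move=> N0.
wlog suff H : h t h' t' / (k < m)%N ->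
  count_below N e m h t = count_below N e m h' t' ->
  (t + N *+ (k + e) < h) -> (t' + N *+ (k + e) < h').
  by move=> km E; apply/idP/idP; apply: H => //.
move=> km eqc lt_h; case: ltP => // le_h'; exfalso.
have mono q s l l' : (l <= l')%N ->
    s + N *+ (l' + e) < q -> s + N *+ (l + e) < q.
  move=> ll'; apply: le_lt_trans.
  by rewrite lerD2l -(subnK ll') -addnA [leRHS]mulrnDr lerDr mulrn_wge0.
suff : (count_below N e m h' t' < count_below N e m h t)%N by rewrite eqc ltnn.
rewrite /count_below (bigD1 (Ordinal km)) //= [ltnRHS](bigD1 (Ordinal km)) //=.
rewrite lt_h ltNge le_h' add0n add1n ltnS; apply: leq_sum => l _.
case: (leqP l k) => lk; first by rewrite (mono _ _ _ _ lk lt_h) leq_b1.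
case: ltP => // lt_l; have := mono _ _ _ _ (ltnW lk) lt_l.
by rewrite ltNge le_h'.
Qed.

End Counting.

(** * Labels and their injectivity *)

Section Labels.
Variables (R : realDomainType) (n : nat) (c : 'I_n -> nat).
Implicit Types (N : R) (y z : 'I_n -> R) (M : {set 'I_n}).

Definition level_count N y (i j : 'I_n) :=
  count_below N (i < j)%N (c i) (y i) (y j).

Definition label N y M j : nat := (\sum_(i in M) level_count N y i j)%N.

Lemma level_count_self N y i : 0 <= N -> level_count N y i i = 0%N.
Proof. by move=> N0; rewrite /level_count count_below0 // ltnn mulr0n addr0. Qed.

(** Here [y j] lies below [y i], by more than [N] if [i < j], so every [l] crosses at least as many
    levels over [j] as over [i]; the index [i] crosses none over itself. *)
Lemma label_lt N y M i j : 0 <= N -> i \in M ->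
  (0 < level_count N y i j)%N -> (label N y M i < label N y M j)%N.
Proof.
move=> N0 iM ij0; have lt_y := count_below_gt0 N0 ij0.
rewrite /label (bigD1 i) //= [ltnRHS](bigD1 i) //= level_count_self // add0n.
rewrite -add1n leq_add // leq_sum // => l _; apply: count_below_le.
case: (ltnP l j) => lj /=; case: (ltnP l i) => li /=;
  rewrite ?mulr0n ?mulr1n ?addr0; move: lt_y.
- by case: (i < j)%N; rewrite ?mulr1n ?mulr0n; lra.
- by rewrite (leq_ltn_trans li lj) mulr1n; lra.
- by case: (i < j)%N; rewrite ?mulr1n ?mulr0n; lra.
- by case: (i < j)%N; rewrite ?mulr1n ?mulr0n; lra.
Qed.

Lemma sum_eq_lt_gt (I : finType) (F G : I -> nat) i :
  (\sum_j F j = \sum_j G j)%N -> (F i < G i)%N -> exists j, (G j < F j)%N.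
Proof.
move=> eqS lti; apply/existsP; apply: contraPT eqS.
rewrite negb_exists => /forallP nex; apply/eqP; rewrite neq_ltn; apply/orP; left.
rewrite (bigD1 i) //= [ltnRHS](bigD1 i) //= -addSn leq_add // leq_sum // => j _.
by rewrite leqNgt nex.
Qed.

(* The gap between the two crossed levels, a multiple of [N], separates [y] from
   [z] in the coordinates [i] and [i'] alone. *)
Lemma opposite_crossings N y z (i i' j : 'I_n) k k' : 0 <= N ->
  (k < c i)%N -> (k' < c i')%N -> (k' + (i' < j) <= k + (i < j))%N ->
  y j + N *+ (k + (i < j)%N) < y i -> z i <= z j + N *+ (k + (i < j)%N) ->
  y i' <= y j + N *+ (k' + (i' < j)%N) -> z j + N *+ (k' + (i' < j)%N) < z i' ->
  level_count N y i i' = level_count N z i i' ->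
  level_count N y i' i = level_count N z i' i -> False.
Proof.
move=> N0 kc kc' /subnK; set d := (_ - _)%N; move: d => d dE.
rewrite -dE mulrnDr => hy hz hy' hz' E E'.
have gy : y i' + N *+ d < y i by lra.
have gz : z i < z i' + N *+ d by lra.
have [ii'|ii'|ii'] := ltngtP i i'; last first.
- have ? := ord_inj ii'; subst i'.
  have := mulrn_wge0 d N0; lra.
- have dc : (d < c i)%N.
    by move: dE; case: (ltnP i j); case: (ltnP i' j) => /=; lia.
  have := count_below_inj N0 dc E.
  by rewrite ltnNge (ltnW ii') /= addn0 gy ltNge (ltW gz).
(* For [i < i'] the levels of [(i, i')] start at 1, so a gap [d = 0] is read off level 0 of
   [(i', i)] instead. *)
case d0 : d => [|d'].
  have := count_below_inj N0 (leq_ltn_trans (leq0n _) kc') E'.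
  move: gy gz; rewrite d0 ltnNge (ltnW ii') /= mulr0n !addr0 => gy ->.
  by rewrite ltNge (ltW gy).
have dc : (d' < c i)%N.
  by move: dE; case: (ltnP i j); case: (ltnP i' j) => /=; lia.
by have := count_below_inj N0 dc E; rewrite ii' addn1 -d0 gy ltNge (ltW gz).
Qed.

Lemma label_inj N y z : 0 <= N ->
  label N y finset.setT =1 label N z finset.setT ->
  forall i j, level_count N y i j = level_count N z i j.
Proof.
move=> N0 eqL i j; have [b] := ubnP (label N y finset.setT j).
elim: b i j => // b IH i j; rewrite ltnS => lb.
have cross u v i0 : label N u finset.setT =1 label N v finset.setT ->
    (label N u finset.setT j <= b)%N ->
    (forall l l', (label N u finset.setT l' < b)%N ->
       level_count N u l l' = level_count N v l l') ->
    (level_count N v i0 j < level_count N u i0 j)%N -> False.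
  move=> uv ub IHuv lt0.
  have sumE : (\sum_l level_count N v l j = \sum_l level_count N u l j)%N.
    have E w : label N w finset.setT j = (\sum_l level_count N w l j)%N.
      by apply: eq_bigl => l; rewrite inE.
    by rewrite -!E uv.
  have [i1 lt1] := sum_eq_lt_gt sumE lt0.
  have [k kc /andP[uk vk]] := count_below_lt lt0.
  have [k' kc' /andP[vk' uk']] := count_below_lt lt1.
  (* Each of [i0] and [i1] crosses a level over [j], one in [u] and the other in [v], so both have
     smaller labels and the induction hypothesis applies to the pair. *)
  have b0 : (label N u finset.setT i0 < b)%N.
    by apply: leq_trans ub; apply: label_lt => //; exact: leq_ltn_trans lt0.
  have b1 : (label N u finset.setT i1 < b)%N.
    apply: leq_trans ub; rewrite !uv.
    by apply: label_lt => //; exact: leq_ltn_trans lt1.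
  (* [opposite_crossings] takes the higher level first; in the second case [u] and [v] exchange
     roles. *)
  have [le_k|/ltnW le_k] := leqP (k' + (i1 < j)) (k + (i0 < j)).
    by apply: (opposite_crossings N0 kc kc' le_k uk vk uk' vk'); exact: IHuv.
  apply: (opposite_crossings N0 kc' kc le_k vk' uk' vk uk); symmetry; exact: IHuv.
apply/eqP; case: ltngtP => // lt_ij; exfalso.
- apply: (cross z y i) => //.
  + by rewrite -eqL.
  + by move=> l l'; rewrite -eqL => /IH ->.
- by apply: (cross y z i) => // l l' /IH ->.
Qed.

End Labels.

(** * Inserting one coordinate at a prescribed label *)

Lemma sum_nat_le1 (I : finType) (P : pred I) (F : I -> nat) :
  (forall i, P i -> F i <= 1)%N ->
  (forall i i', P i -> P i' -> 0 < F i -> 0 < F i' -> i = i')%N ->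
  (\sum_(i | P i) F i <= 1)%N.
Proof.
move=> F1 uniqF.
have [/existsP[i /andP[Pi Fi]]|] := boolP [exists i, P i && (0 < F i)%N].
  rewrite (bigD1 i) //= big1 ?addn0 ?F1 // => i' /andP[Pi' ne].
  apply/eqP; rewrite -leqn0 leqNgt; apply: contraNN ne => Fi'.
  by apply/eqP; apply: uniqF.
rewrite negb_exists => /forallP F0; rewrite big1 // => i Pi.
by apply/eqP; have := F0 i; rewrite Pi lt0n negbK.
Qed.

Lemma count_below_double (N h t : int) e m :
  count_below (N * 2) e m (h * 2) (t * 2) = count_below N e m h t.
Proof.
apply: eq_bigr => k _; congr nat_of_bool; rewrite -mulrnAl.
by move: (N *+ _) => X; lia.
Qed.

(** After doubling, heights and levels are even, so raising the base by 1 changes no strict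
    comparison. *)
Lemma count_below_double1 (N h t : int) e m :
  count_below (N * 2) e m (h * 2) (t * 2 + 1) = count_below N e m h t.
Proof.
apply: eq_bigr => k _; congr nat_of_bool; rewrite -mulrnAl.
by move: (N *+ _) => X; lia.
Qed.

Lemma mulrn_int (N : int) k : N *+ k = N * k%:Z.
Proof. by rewrite -mulr_natr natz. Qed.

Section Insertion.
Variables (n : nat) (c : 'I_n -> nat) (N : int) (Y : 'I_n -> int).
Variables (M : {set 'I_n}) (j : 'I_n).
Hypothesis N0 : 0 < N.
Hypothesis sepY : forall i l, i \in M -> l \in M -> i != l ->
  forall k : int, Y i != Y l + N * k.
Hypothesis jM : j \notin M.

(** The label that [j] would receive at height [u]. *)
Let F (u : int) : nat :=
  (\sum_(l in M) count_below N (l < j)%N (c l) (Y l) u)%N.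

Let F_le u v : u <= v -> (F v <= F u)%N.
Proof.
by move=> uv; apply: leq_sum => l _; apply: count_below_le; rewrite lerD2r.
Qed.

(** The newly crossed levels are those equal to some [Y l] at height [u]. Two of them with distinct
    [l] would make two coordinates congruent modulo [N], against [sepY]; for one [l], the level
    fixes [k]. *)
Let F_step u : (F (u - 1) <= (F u).+1)%N.
Proof.
pose b (l : 'I_n) (k : nat) : nat := (u + N *+ (k + (l < j)%N) == Y l).
have le_b : (F (u - 1)%R <= F u + \sum_(l in M) \sum_(k < c l) b l k)%N.
  rewrite /F -big_split; apply: leq_sum => l _.
  rewrite -big_split; apply: leq_sum => k _ /=; rewrite /b.
  by move: (N *+ _) => X; case: eqP; case: ltP; case: ltP => //=; lia.
rewrite (leq_trans le_b) // -addn1 leq_add2l.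
apply: sum_nat_le1 => [l _|l l' lM l'M].
  apply: sum_nat_le1 => [k _|k k' _ _]; first exact: leq_b1.
  rewrite !lt0b => /eqP <- /eqP /addrI; rewrite !mulrn_int.
  by move/mulfI => /(_ (lt0r_neq0 N0)) [] /addIn /ord_inj.
rewrite !lt0n !sum_nat_eq0 => /forallPn[k +] /forallPn[k' +].
rewrite /= !eqb0 !negbK => /eqP E /eqP E'; apply/eqP; apply: contraT => ne.
have /negP[] := sepY lM l'M ne ((k + (l < j))%N%:Z - (k' + (l' < j))%N%:Z).
rewrite -E -E' !mulrn_int; apply/eqP; ring.
Qed.

(** This is the greatest height at which [j] lies strictly below the first level that would affect
    the label of [i]. The [- 1] yields only weak inequalities for the levels of [i]; [sepY] makes
    them strict. *)
Let F_label i : i \in M -> (F (Y i + N *+ (j < i)%N - 1) <= label c N Y M i)%N.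
Proof.
move=> iM; apply: leq_sum => l lM.
have [->|li] := eqVneq l i.
  rewrite (count_below0 _ (ltW N0)) //.
  case: (ltngtP j i) => /= [_|_|]; rewrite ?mulr1n ?mulr0n; try lia.
  by move/ord_inj => E; move: jM; rewrite E iM.
apply: leq_sum => k _; case: ltP => // lt_Y; rewrite lt0b lt_neqAle.
rewrite eq_sym mulrn_int sepY //= -mulrn_int.
move: lt_Y; rewrite !mulrnDr; move: (N *+ k) => X.
by case: (ltngtP j i) => ij; case: (ltnP l j) => lj; case: (ltnP l i) => li' /=;
  rewrite ?mulr1n ?mulr0n; lia.
Qed.

Lemma insertion_height A : (forall i, i \in M -> label c N Y M i <= A)%N ->
  (A <= \sum_(i in M) c i)%N ->
  exists2 u, F u = A & forall i, i \in M -> u < Y i + N *+ (j < i)%N.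
Proof.
move=> le_A A_le.
(* At [top] no level is crossed; at [- bot - 1] all of them are, which gives the label
   [\sum_(i in M) c i]. *)
pose top : int := \sum_(i in M) `|Y i|.
pose bot : int := \sum_(i in M) (`|Y i| + N * (c i).+1%:Z).
have le_sum (G : 'I_n -> int) i : (forall l, 0 <= G l) -> i \in M ->
    G i <= \sum_(l in M) G l.
  by move=> G0 iM; rewrite (bigD1 i) //= lerDl sumr_ge0.
have top_ge i : i \in M -> Y i <= top.
  move=> iM; apply: le_trans (le_sum (fun l => `|Y l|) i _ iM) => //.
  exact: ler_norm.
have g0 l : 0 <= `|Y l| + N * (c l).+1%:Z.
  by rewrite addr_ge0 // mulr_ge0 // ltW.
have bot_ge i : i \in M -> N * (c i).+1%:Z - Y i <= bot.
  move=> iM; apply: le_trans (le_sum _ i g0 iM).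
  by rewrite addrC lerD2r -normrN ler_norm.
(* Descending from [top], the first good height is the one sought: its label is at least [A], and
   minimality of [s] gives the reverse bound. *)
pose good (s : nat) := (A <= F (top - s%:Z)%R)%N &&
  [forall i in M, top - s%:Z < Y i + N *+ (j < i)%N].
have ex_good : exists s, good s.
  exists (absz (top + bot + 1)); rewrite /good gez0_abs; last first.
    by rewrite !addr_ge0 // sumr_ge0.
  have -> : top - (top + bot + 1) = - bot - 1 by ring.
  apply/andP; split.
    apply: leq_trans A_le _; apply: leq_sum => i iM.
    rewrite -[leqLHS]muln1 -[X in (X * _ <= _)%N]card_ord -sum_nat_const.
    apply: leq_sum => k _; rewrite lt0b mulrn_int.
    have : N * (k + (i < j))%N%:Z <= N * (c i).+1%:Z.
      rewrite ler_pM2l // lez_nat -[leqRHS]addn1 leq_add ?leq_b1 //; exact: ltnW.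
    by have := bot_ge i iM; lia.
  apply/forall_inP => i iM; have := bot_ge i iM.
  have : 0 <= N *+ (j < i)%N by rewrite mulrn_wge0 // ltW.
  have : 0 <= N * (c i).+1%:Z by rewrite mulr_ge0 // ltW.
  by lia.
have [s /andP[Fs /forall_inP taus] min_s] := ex_minnP ex_good.
exists (top - s%:Z) => //; apply/eqP; rewrite eqn_leq Fs andbT.
case: s Fs taus min_s => [|s] Fs taus min_s.
  rewrite [leqLHS](_ : _ = 0%N) //; apply: big1 => i iM; rewrite (count_below0 _ (ltW N0)) //.
  rewrite subr0 (le_trans (top_ge i iM)) // lerDl mulrn_wge0 //; exact: ltW.
have : ~~ good s by apply/negP => /min_s; rewrite ltnn.
have sE : top - s.+1%:Z = top - s%:Z - 1 by lia.
(* One unit higher, either the label is below [A] and [F_step] applies, or the bound at some [i]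
   fails and [F_label] compares with the label of [i]. *)
rewrite negb_and -ltnNge => /orP[lt_A|/forall_inPn[i iM]].
  by rewrite sE; exact: leq_trans (F_step _) _.
rewrite -leNgt => le_s; apply: leq_trans (le_A i iM); apply: leq_trans (F_label iM).
by rewrite sE; apply: F_le; rewrite lerD2r.
Qed.
End Insertion.

(** * Integral coordinates with prescribed labels *)

Lemma label_realization n (c a : 'I_n -> nat) (M : {set 'I_n}) :
  (forall v, v \in M -> a v <= \sum_(i in M | a i < a v) c i)%N ->
  exists (N : int) (Y : 'I_n -> int), [/\ 0 < N,
    forall i l, i \in M -> l \in M -> i != l ->
      forall k : int, Y i != Y l + N * k &
    forall v, v \in M -> label c N Y M v = a v].
Proof.
have [b] := ubnP #|M|; elim: b M => // b IH M; rewrite ltnS => Mb le_a.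
have [->|[i0 i0M]] := set_0Vmem M.
  by exists 1, (fun=> 0); split=> // i *; have : i \in finset.set0 by []; rewrite inE.
(* An index of maximal value occurs in none of the bounding sums, so deleting it preserves the
   hypothesis. *)
have [j jM maxj] : exists2 j, j \in M & forall i, i \in M -> (a i <= a j)%N.
  by case: (@arg_maxnP _ i0 (mem M) a i0M) => j; exists j.
have card_M := cardsD1 j M; rewrite jM in card_M.
have jM' : j \notin (M :\ j)%SET by rewrite !inE eqxx.
have le_a' v : v \in (M :\ j)%SET ->
    (a v <= \sum_(i in (M :\ j)%SET | a i < a v) c i)%N.
  rewrite !inE => /andP[_ vM]; rewrite (leq_trans (le_a v vM)) //.
  apply: eq_leq; apply: eq_bigl => i; rewrite !inE.
  by case: eqVneq => //= ->; rewrite ltnNge (maxj v vM) andbF.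
have [|N [Y [N0 sepY labY]]] := IH _ _ le_a'; first by lia.
have [|| u Fu u_lt] := @insertion_height n c N Y _ j N0 sepY jM' (a j).
- move=> i iM; rewrite labY //; apply: maxj.
  by move: iM; rewrite !inE => /andP[].
- apply: leq_trans (le_a j jM) _; rewrite big_mkcondr [leqRHS]big_mkcond /=.
  rewrite [leqLHS]big_mkcond /=; apply: leq_sum => i _; rewrite !inE.
  case: eqVneq => [->|_] /=; first by rewrite ltnn if_same.
  by case: (i \in M) => //; case: (_ < _)%N.
(* Old coordinates become even and the new one odd, hence incongruent modulo the even unit
   [N * 2]. *)
pose Y' i := if i == j then u * 2 + 1 else Y i * 2.
have Y'j : Y' j = u * 2 + 1 by rewrite /Y' eqxx.
have Y'M i : i \in (M :\ j)%SET -> Y' i = Y i * 2.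
  by rewrite !inE /Y' => /andP[/negbTE ->].
exists (N * 2), Y'; split; first by rewrite mulr_gt0.
  move=> i l iM lM il k; rewrite /Y'.
  rewrite [N * 2 * k]mulrAC.
  case: (eqVneq i j) => [ij|ij]; case: (eqVneq l j) => [lj|lj].
  - by rewrite ij lj eqxx in il.
  - by apply/eqP; move: (N * k) => X; lia.
  - by apply/eqP; move: (N * k) => X; lia.
  - by rewrite -mulrDl (inj_eq (mulIf _)) //; apply: sepY; rewrite ?inE ?ij ?lj.
have N20 : 0 <= N * 2 by rewrite mulr_ge0 // ltW.
move=> v vM; rewrite /label (big_setD1 j) //= /level_count.
have [->|vj] := eqVneq v j.
  rewrite (count_below0 _ N20) ?ltnn ?mulr0n ?addr0 // add0n.
  rewrite -Fu; apply: eq_bigr => l lM.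
  by rewrite Y'j Y'M // count_below_double1.
have vM' : v \in (M :\ j)%SET by rewrite !inE vj.
rewrite (count_below0 _ N20) ?add0n; last first.
  rewrite Y'j Y'M // -mulrnAl; have := u_lt v vM'; move: (N *+ _) => X; lia.
rewrite -labY //; apply: eq_bigr => l lM.
by rewrite !Y'M // count_below_double.
Qed.

(** * Building functions characterized by inequalities *)

Lemma buildingP n (c : 'I_n -> nat) (a : {ffun 'I_n -> nat}) :
  building c a <-> forall v, (a v <= \sum_(i | a i < a v) c i)%N.
Proof.
split=> [ba v|le_a].
  pose S := [set i | (a i < a v)%N]%SET.
  have sumS : (\sum_(i | a i < a v) c i = \sum_(i in S) c i)%N.
    by apply: eq_bigl => i; rewrite inE.
  (* When the first index outside [S] enters, [M] is still inside [S]; its value is at least [a v],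
     which gives the bound. Such an index exists since [v] is not in [S]. *)
  suff H t M : build_run c a t M ->
      M \subset S \/ (a v <= \sum_(i in S) c i)%N.
    rewrite sumS; case: (H _ _ ba) => // /fintype.subsetP /(_ v).
    by rewrite !inE ltnn => /(_ isT).
  elim=> [|{}t {}M w _ [MS|]]; [left; exact: finset.sub0set| |by right].
  rewrite !inE => /andP[_ le_w]; have [wS|wS] := boolP (w \in S).
    by left; rewrite finset.subUset finset.sub1set wS.
  right; move: wS; rewrite inE -leqNgt => /leq_trans -> //.
  rewrite (leq_trans le_w) // [leqRHS](big_setID M) /= (finset.setIidPr MS).
  exact: leq_addr.
apply/building_no_deadlock => t M _ MT.
have /set0Pn[i0 i0M] : (~: M)%SET != finset.set0.
  by apply: contraNneq MT => CM0; rewrite -[M]finset.setCK CM0 finset.setC0.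
(* A waiting index of least value is eligible: all indices of smaller value are already in [M]. *)
have [v vM minv] : exists2 v, v \in (~: M)%SET &
    forall i, i \in (~: M)%SET -> (a v <= a i)%N.
  by case: (@arg_minnP _ i0 (mem (~: M)%SET) a i0M) => v; exists v.
apply/set0Pn; exists v; rewrite inE vM (leq_trans (le_a v)) //.
rewrite big_mkcond [leqRHS]big_mkcond /=; apply: leq_sum => i _.
case: ifP => // lt_i; case: ifPn => // iM.
by move: lt_i; rewrite ltnNge minv // inE.
Qed.

(** * Regions as classes of equal level counts *)

Local Open Scope classical_set_scope.

Section Regions.
Variables (R : realType) (n : nat) (c : 'I_n -> nat).
Implicit Types (x z w : 'rV[R]_n) (i j : 'I_n).

(* Since 2 m_i = c_i + 1_I(i), this is the translation that turns the range of k
   for x_i - x_j into 1 - c_j, ..., c_i when i < j. *)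
Definition shi_shift i : int := (odd_ind c i)%:Z - (half_weight c i)%:Z.

Definition shifted x i : R := x ord0 i - (shi_shift i)%:~R.

Let half_weightE i : (half_weight c i * 2 = c i + odd_ind c i)%N.
Proof. by rewrite /half_weight /odd_ind; case: ifP => ci /=; lia. Qed.

Lemma shi_complementP x : arr_complement (shi_arrangement R c) x <->
  forall i j k, i != j -> (k < c i)%N ->
    shifted x j + 1 *+ (k + (i < j)%N) != shifted x i.
Proof.
split=> [xA i j k ij kc|sepx].
  apply/eqP => E; apply: xA.
  case: (ltngtP i j) E => [lt_ij|lt_ji|/ord_inj eij]; last by rewrite eij eqxx in ij.
    rewrite /shifted => E; pose K := k.+1%:Z + shi_shift i - shi_shift j.
    exists (diff_hyperplane i j K); last first.
      rewrite /diff_hyperplane /= /K; move: E; rewrite addn1.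
      move: (shi_shift i) (shi_shift j) => si sj.
      by rewrite !(rmorphD, rmorphN) /= -pmulrn; lra.
    exists i, j, K; split=> //; rewrite /K /shi_shift;
      by have := half_weightE i; have := half_weightE j; lia.
  rewrite /shifted addn0 => E; pose K := - k%:Z + shi_shift j - shi_shift i.
  exists (diff_hyperplane j i K); last first.
    rewrite /diff_hyperplane /= /K; move: E.
    move: (shi_shift i) (shi_shift j) => si sj.
    by rewrite !(rmorphD, rmorphN) /= -pmulrn; lra.
  exists j, i, K; split=> //; rewrite /K /shi_shift;
    by have := half_weightE i; have := half_weightE j; lia.
move=> [H [i [j [K [ij leK Kle ->]]]]]; rewrite /diff_hyperplane /= => E.
have ne : i != j by apply: contraTneq ij => ->; rewrite ltnn.
pose d := K - shi_shift i + shi_shift j.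
have dE : shifted x i - shifted x j = d%:~R.
  rewrite /shifted /d; move: (shi_shift i) (shi_shift j) => si sj.
  by rewrite !(rmorphD, rmorphN) /= -E; ring.
have d_ge : 1 - (c j)%:Z <= d.
  by rewrite /d /shi_shift; have := half_weightE i; have := half_weightE j; lia.
have d_le : d <= (c i)%:Z.
  by rewrite /d /shi_shift; have := half_weightE i; have := half_weightE j; lia.
(* A positive [d] is level [d - 1] of [(i, j)], whose offset is 1; a nonpositive [d] is level [- d]
   of [(j, i)]. *)
case: d dE d_ge d_le => [[|k]|k] dE d_ge d_le.
- have cj : (0 < c j)%N by lia.
  move: (sepx j i 0%N); rewrite eq_sym => /(_ ne cj) /eqP; apply.
  by rewrite ltnNge (ltnW ij) /=; move: dE; rewrite mulr0n; lra.
- have ci : (k < c i)%N by lia.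
  move: (sepx i j k ne ci) => /eqP; apply.
  by rewrite ij addn1; move: dE; rewrite -pmulrn; lra.
- have cj : (k.+1 < c j)%N by lia.
  move: (sepx j i k.+1); rewrite eq_sym => /(_ ne cj) /eqP; apply.
  rewrite ltnNge (ltnW ij) addn0; move: dE.
  by rewrite NegzE rmorphN /= -pmulrn; lra.
Qed.

Notation levels x := (level_count c 1 (shifted x)).
Notation shi_complement := (arr_complement (shi_arrangement R c)).

(** Equal counts put [x] and [z] on the same side of every level, so the segment joining them avoids
    the arrangement. *)
Lemma levels_component x z : shi_complement x -> shi_complement z ->
  (forall i j, levels x i j = levels z i j) ->
  connected_component shi_complement x z.
Proof.
move=> xA zA eq_l; pose g (t : R) : 'rV[R]_n := x + t *: (z - x).
exists (g @` `[0, 1]); last first.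
  by exists 1; rewrite /g /= ?in_itv /= ?lexx ?ler01 // scale1r addrC subrK.
split.
- by exists 0; rewrite /g /= ?in_itv /= ?lexx ?ler01 // scale0r addr0.
- move=> _ [t /= + <-]; rewrite in_itv /= => /andP[t0 t1].
  apply/shi_complementP => i j k ij kc.
  have gE l : shifted (g t) l = (1 - t) * shifted x l + t * shifted z l.
    by rewrite /shifted !mxE; ring.
  have pos a b : 0 < a -> 0 < b -> 0 < (1 - t) * a + t * b.
    have [->|tn0] := eqVneq t 0; first by rewrite subr0 mul1r mul0r addr0.
    move=> a0 b0; apply: ltr_wpDl; first by rewrite mulr_ge0 ?subr_ge0 // ltW.
    by rewrite mulr_gt0 // lt_def tn0.
  rewrite !gE; have := count_below_inj ler01 kc (eq_l i j).
  have /eqP := (shi_complementP x).1 xA i j k ij kc.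
  have /eqP := (shi_complementP z).1 zA i j k ij kc.
  move: (shifted x i) (shifted x j) (shifted z i) (shifted z j) (1 *+ _).
  move=> xi xj zi zj q zne xne.
  case: ltP => hx /esym => [hz|/negbT].
    have := pos (xi - xj - q) (zi - zj - q); rewrite !subr_gt0 !ltrBrDl.
    by move=> /(_ hx hz) ?; apply/eqP; lra.
  rewrite -leNgt => hz.
  have := pos (xj + q - xi) (zj + q - zi); rewrite !subr_gt0 !lt_neqAle hx hz.
  rewrite !andbT => /(_ (introN eqP (nesym xne)) (introN eqP (nesym zne))) ?.
  by apply/eqP; lra.
- apply: connected_continuous_connected; first exact: segment_connected.
  apply: continuous_subspaceT => t.
  by apply: cvgD; [exact: cvg_cst|apply: cvgZr_tmp; exact: cvg_id].
Qed.

(** A coordinate difference maps a connected set onto an interval, and an interval that misses a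
    level lies on one side of it. *)
Lemma component_levels x z : connected_component shi_complement x z ->
  forall i j, levels x i j = levels z i j.
Proof.
move=> [B [Bx BA Bc Bz]] i j.
have [->|ij] := eqVneq i j; first by rewrite !level_count_self.
pose g w := shifted w i - shifted w j.
have gB : is_interval (g @` B).
  apply/connected_intervalP/connected_continuous_connected => //.
  have shifted_cont l : continuous (shifted^~ l).
    move=> w; apply: continuousB; first exact: coord_continuous.
    exact: cst_continuous.
  apply: continuous_subspaceT => w.
  exact: (continuousB (shifted_cont i w) (shifted_cont j w)).
have noB k : (k < c i)%N -> ~ (g @` B) (1 *+ (k + (i < j)%N)).
  move=> kc [w /BA /shi_complementP /(_ i j k ij kc) /eqP ne]; rewrite /g => E.
  by apply: ne; rewrite -E addrC subrK.
apply: eq_bigr => k _; congr nat_of_bool; have kc := ltn_ord k.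
have Gx : (g @` B) (g x) by exists x.
have Gz : (g @` B) (g z) by exists z.
move: (noB k kc) (gB _ _ Gx Gz (1 *+ (k + (i < j)%N))).
move/(_ _ _ Gz Gx (1 *+ (k + (i < j)%N))): gB; rewrite /g; move: (1 *+ _) => q zx nq xz.
by apply/idP/idP => h; rewrite ltNge; apply/negP => h'; apply: nq;
  [apply: zx|apply: xz]; lra.
Qed.

Definition shi_label x : {ffun 'I_n -> nat} :=
  [ffun j => label c 1 (shifted x) finset.setT j].

Lemma shi_label_building x : building c (shi_label x).
Proof.
apply/buildingP => v; have -> : (\sum_(i | shi_label x i < shi_label x v) c i =
           \sum_(i in finset.setT) if shi_label x i < shi_label x v then c i else 0)%N.
  by rewrite big_mkcond /=; apply: eq_bigl => i; rewrite inE.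
rewrite [leqLHS]ffunE; apply: leq_sum => i _.
case: (posnP (levels x i v)) => [->//|pos_i].
by rewrite !ffunE label_lt ?inE // count_below_max.
Qed.

Lemma shi_label_surj (a : {ffun 'I_n -> nat}) : building c a ->
  exists2 x, shi_complement x & shi_label x = a.
Proof.
move=> /buildingP le_a.
have [|N [Y [N0 sepY labY]]] := @label_realization n c a finset.setT.
  by move=> v _; rewrite (eq_bigl (fun i => a i < a v)%N) // => i; rewrite inE.
(* Dividing by [N] rescales the unit to 1; adding [shi_shift] undoes the translation in
   [shifted]. *)
pose x : 'rV[R]_n := \row_i ((Y i)%:~R / N%:~R + (shi_shift i)%:~R).
have N0R : 0 < N%:~R :> R by rewrite ltr0z.
have xE i : shifted x i = (Y i)%:~R / N%:~R by rewrite /shifted mxE addrK.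
have levelE j k : shifted x j + 1 *+ k = (Y j + N *+ k)%:~R / N%:~R.
  by rewrite xE rmorphD rmorphMn mulrDl mulrnAl divff // gt_eqF.
exists x.
  apply/shi_complementP => i j k ij kc.
  have invN : N%:~R^-1 != 0 :> R by rewrite invr_eq0 gt_eqF.
  by rewrite levelE xE (inj_eq (mulIf invN)) eqr_int eq_sym mulrn_int sepY ?inE.
apply/ffunP => j; rewrite ffunE -labY ?inE //; apply: eq_bigr => i _.
apply: eq_bigr => k _; rewrite levelE xE ltr_pM2r ?invr_gt0 //.
by rewrite ltr_int.
Qed.

End Regions.

(** * The bijection through representatives of regions *)

Theorem theorem3 (R : realType) (n : nat) (c : 'I_n -> nat)
    (hn : (1 <= n)%N) (hc : forall i : 'I_n, (0 < c i)%N) :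
  exists f : set 'rV[R]_n -> {ffun 'I_n -> nat},
    set_bij (regions (shi_arrangement R c)) (building c) f.
Proof.
set A := arr_complement (shi_arrangement R c).
(* The default 0 is returned only for an empty [C], and regions are nonempty. *)
pose f (C : set 'rV[R]_n) := shi_label c (xget 0 C).
have fP x : A x -> connected_component A x (xget 0 (connected_component A x)).
  by move=> Ax; apply: (@xgetI _ _ _ x); exact: connected_component_refl.
exists f; split=> [_ [x _ ->]|C C' /set_mem [x Ax ->] /set_mem [x' Ax' ->]|a].
- exact: shi_label_building.
- rewrite /f => eq_f; have [xy x'y'] := (fP _ Ax, fP _ Ax').
  move: (xget _ _) (xget _ _) eq_f xy x'y' => y y' eq_f xy x'y'.
  rewrite (same_connected_component xy) (same_connected_component x'y').
  apply: same_connected_component; apply: levels_component.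
  + exact: connected_component_sub xy.
  + exact: connected_component_sub x'y'.
  + by apply: label_inj => // j; move/ffunP/(_ j): eq_f; rewrite !ffunE.
- move=> /(shi_label_surj R) [x Ax <-]; exists (connected_component A x).
    by exists x.
  apply/ffunP => j; rewrite !ffunE; apply: eq_bigr => i _.
  by apply/esym; apply: component_levels; exact: fP.
Qed.
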